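(* Let $G$ be a finite group, let $\rho:G\to U(V)$ be a unitary representation on a finite-dimensional complex inner product space $V$, let $\chi$ be an irreducible complex character of $G$ of degree $d=\chi(1)$, and suppose that the $\chi$-isotypic component $V_\chi$ of $V$ is nonzero. Then on the unit sphere of $V_\chi$, $$\max_{v\in V_\chi,\ \|v\|=1}F(v)=\frac1d .$$ Moreover, the maximizers are exactly the unit vectors $v\in V_\chi$ which generate irreducible summands affording $\chi$, i.e. those for which $\operatorname{span}\{\rho(g)v:g\in G\}$ is an irreducible subrepresentation with character $\chi$.
   Context: All representations are complex. Hermitian inner products are conjugate-linear in the first variable and linear in the second. The $\chi$-isotypic projector on $V$ is $P_\chi=\frac{d}{|G|}\sum_{g\in G}\overline{\chi(g)}\,\rho(g)$, and the $\chi$-isotypic component is its image $V_\chi=P_\chi V$. For $v\in V$, $F(v)=\frac1{|G|}\sum_{g\in G}|\langle v,\rho(g)v\rangle|^2$. *)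

(* Defs.v *)
From HB Require Import structures.
From mathcomp Require Export all_boot all_order all_fingroup all_algebra.
From mathcomp Require Export mxrepresentation sesquilinear complex reals.

Set Implicit Arguments.
Unset Strict Implicit.
Unset Printing Implicit Defensive.

Import Order.TTheory GRing.Theory Num.Theory.
Local Open Scope ring_scope.

Section Definitions.
Variables (C : numClosedFieldType) (gT : finGroupType) (G : {group gT}).
Variables (V : vectType C) (form : {dot V for Num.conj}).
Variables (rho : gT -> 'End(V)) (chi : gT -> C).
Implicit Types (v : V) (W : {vspace V}).

(* A form of type {dot V for Num.conj} is linear in its first variable; the
   inner product below is conjugate-linear in the first variable and linear
   in the second. *)
Definition inner (u v : V) : C := form v u.

Definition hnorm v : C := sqrtC (inner v v).

(* Only the values of rho on G matter. *)
Definition unitary_repr : Prop :=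
  [/\ rho 1%g = \1%VF,
      {in G &, forall g h, rho (g * h)%g = (rho g \o rho h)%VF} &
      {in G, forall g u v, inner (rho g u) (rho g v) = inner u v}].

Definition subrepr W : Prop := {in G, forall g, (rho g @: W <= W)%VS}.

Definition irr_subrepr W : Prop :=
  [/\ subrepr W, W != 0%VS &
      forall U : {vspace V}, subrepr U -> (U <= W)%VS -> U != 0%VS -> U = W].

(* The matrix, in a basis of W, of an endomorphism f that preserves W. *)
Definition restr_mx (f : 'End(V)) W : 'M[C]_(\dim W) :=
  \matrix_(i, j) coord (vbasis W) i (f (vbasis W)`_j).

Definition has_character W : Prop :=
  {in G, forall g, \tr (restr_mx (rho g) W) = chi g}.

Definition irr_character : Prop :=
  exists n (rG : mx_representation C G n),
    mx_irreducible rG /\ {in G, forall g, \tr (rG g) = chi g}.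

Definition isotypic_proj : 'End(V) :=
  (chi 1%g / #|G|%:R) *: \sum_(g in G) (chi g)^* *: rho g.

Definition isotypic : {vspace V} := limg isotypic_proj.

Definition orbit_span v : {vspace V} := <<[seq rho g v | g in G]>>%VS.

(* The values of F are real numbers, regarded as elements of C. *)
Definition F v : C :=
  #|G|%:R^-1 * \sum_(g in G) `|inner v (rho g v)| ^+ 2.

Definition isotypic_sphere v : Prop := v \in isotypic /\ hnorm v = 1.

End Definitions.

Definition is_maximizer (T : Type) (C : numDomainType)
    (S : T -> Prop) (f : T -> C) (x : T) : Prop :=
  S x /\ forall y, S y -> f y <= f x.

Definition is_max (T : Type) (C : numDomainType)
    (S : T -> Prop) (f : T -> C) (m : C) : Prop :=
  exists2 x, is_maximizer S f x & f x = m.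

(* Main.v *)
Require Import Defs.
From HB Require Import structures.
From mathcomp Require Import spectral.

(** Write [<u, w>] for the inner product and attach to a unit vector [v] of the
    isotypic component [Vchi] its frame operator
      [A u = 1/|G| * \sum_g <rho g v, u> *: rho g v],
    the average of the rank-one projectors onto the orbit of [v].  Averaging
    over [G] makes [A] commute with the representation; it is self-adjoint and
    nonnegative, and [F v = <v, A v>] ([F_frame_op]).  So [F v] is at most the
    largest eigenvalue of [A] on [Vchi], and everything reduces to bounding the
    eigenvalues.

    Let [a] be an eigenvalue and [E] its eigenspace in [Vchi].  Summing
    [<e, A e> = a] over an orthonormal basis of [E] gives
    [\dim E * a = 1/|G| * \sum_g (squared norm of the projection of rho g v
    on E)], which is at most 1 by Bessel, with equality when [E] contains the
    orbit ([frame_op_eigen_le], [frame_op_eigen_eq]).  But [E] is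
    [G]-invariant and nonzero, hence has dimension at least the degree [d]
    ([dim_subrepr_isotypic]), and therefore [a <= 1/d].

    When [F v = 1/d], diagonalizing [A] shows that [v] only has components
    along eigenvectors for [1/d], so [A v = v/d] ([F_le]).  The orbit span then
    lies in that eigenspace and the trace identity forces its dimension to be
    exactly [d]; by minimality of [d] it is irreducible and affords [chi].
    Conversely, on an irreducible orbit span of dimension [d], [A] is a scalar
    [a] by Schur's lemma, the trace identity gives [d * a = 1], and
    [F v = <v, A v> = 1/d].

    The representation theory needed is that a nonzero invariant subspace of
    [Vchi] contains a copy of the irreducible matrix representation [rG]
    affording [chi] ([subrepr_intertwining]).  Unfolding [chi g^-1] as a trace
    writes [isotypic_proj] as a sum of vectors belonging to tuples that
    [G] permutes linearly through the matrices [rG g]; such a tuple is either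
    zero or free, by irreducibility, and Schur's orthogonality relations show
    that the projector fixes its entries. *)

Set Implicit Arguments.
Unset Strict Implicit.
Unset Printing Implicit Defensive.

Import Order.TTheory GRing.Theory Num.Theory.
Local Open Scope ring_scope.
Local Open Scope sesquilinear_scope.

(** * Orthonormal bases and the spectral theorem *)

Section Hermitian.
Variables (C : numClosedFieldType) (V : vectType C).
Variable form : {dot V for Num.conj}.
Implicit Types (u v w e : V) (U : {vspace V}) (s : seq V).

Local Notation "''[' u , v ]" := (inner form u v) : ring_scope.

Lemma innerC u v : '[u, v] = '[v, u]^*.
Proof. by rewrite /inner hermC mul1r. Qed.

Lemma innerDr u v w : '[u, v + w] = '[u, v] + '[u, w].
Proof. exact: linearDl. Qed.

Lemma innerBr u v w : '[u, v - w] = '[u, v] - '[u, w].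
Proof. exact: linearBl. Qed.

Lemma innerZr a u v : '[u, a *: v] = a * '[u, v].
Proof. exact: linearZl_LR. Qed.

Lemma innerBl u v w : '[v - w, u] = '[v, u] - '[w, u].
Proof. exact: linearBr. Qed.

Lemma innerZl a u v : '[a *: u, v] = a^* * '[u, v].
Proof. exact: linearZr_LR. Qed.

Lemma inner_sumr I (r : seq I) (P : pred I) (E : I -> V) u :
  '[u, \sum_(i <- r | P i) E i] = \sum_(i <- r | P i) '[u, E i].
Proof. exact: linear_sumlz. Qed.

Lemma inner_suml I (r : seq I) (P : pred I) (E : I -> V) u :
  '[\sum_(i <- r | P i) E i, u] = \sum_(i <- r | P i) '[E i, u].
Proof. exact: linear_sumr. Qed.

Lemma inner_ge0 u : 0 <= '[u, u].
Proof. exact: dnorm_ge0. Qed.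

Lemma inner_eq0 u : ('[u, u] == 0) = (u == 0).
Proof. exact: dnorm_eq0. Qed.

Lemma hnorm_eq1 u : hnorm form u = 1 <-> '[u, u] = 1.
Proof.
rewrite /hnorm; split=> [u1|->]; last by rewrite sqrtC1.
by rewrite -[LHS]sqrtCK u1 expr1n.
Qed.

Lemma normalize e : e != 0 -> exists a, '[a *: e, a *: e] = 1.
Proof.
move=> e0; have h0 : hnorm form e != 0 by rewrite sqrtC_eq0 inner_eq0.
exists (hnorm form e)^-1.
rewrite innerZr innerZl geC0_conj ?invr_ge0 ?sqrtC_ge0 ?inner_ge0 //.
by rewrite mulrA -expr2 exprVn sqrtCK mulVf // inner_eq0.
Qed.

Lemma inner_orthonormal s e f : orthonormal form s ->
  e \in s -> f \in s -> '[e, f] = (e == f)%:R.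
Proof. by move=> /orthonormalP[_ o1] se sf; rewrite /inner o1 // eq_sym. Qed.

Lemma inner_orthonormal_sum s (k : V -> C) e : orthonormal form s -> e \in s ->
  '[e, \sum_(f <- s) k f *: f] = k e.
Proof.
move=> os se; have /orthonormalP[us _] := os.
rewrite inner_sumr (bigD1_seq e) //= innerZr (inner_orthonormal os) // eqxx.
rewrite mulr1 big_seq_cond big1 ?addr0 // => f /andP[sf fe].
by rewrite innerZr (inner_orthonormal os) // eq_sym (negbTE fe) mulr0.
Qed.

Lemma orthonormal_expansion s v : orthonormal form s -> v \in <<s>>%VS ->
  v = \sum_(e <- s) '[e, v] *: e.
Proof.
move=> os sv; have [k vE _] := free_span (orthonormal_free os) sv.
rewrite [LHS]vE big_seq [RHS]big_seq; apply: eq_bigr => e se.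
by rewrite vE inner_orthonormal_sum.
Qed.

(** With [p] the projection of [v] on the span of [s], the sum on the left is
    [<p, p> = <p, v>], so the inequality is nonnegativity of
    [<v - p, v - p>]. *)
Lemma bessel s v : orthonormal form s ->
  \sum_(e <- s) `|'[e, v]| ^+ 2 <= '[v, v].
Proof.
move=> os; pose p := \sum_(e <- s) '[e, v] *: e.
have pv u : '[p, u] = \sum_(e <- s) '[e, v]^* * '[e, u].
  by rewrite inner_suml; apply: eq_bigr => e _; rewrite innerZl.
have pp : '[p, p] = '[p, v].
  rewrite !pv big_seq [RHS]big_seq; apply: eq_bigr => e se.
  by rewrite inner_orthonormal_sum.
have pE : '[p, v] = \sum_(e <- s) `|'[e, v]| ^+ 2.
  by rewrite pv; apply: eq_bigr => e _; rewrite normCK mulrC.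
have vp : '[v, p] = '[p, v] by rewrite innerC -pp -innerC.
have := inner_ge0 (v - p); rewrite innerBr !innerBl vp pp subrr subr0.
by rewrite pE subr_ge0.
Qed.

Lemma parseval s v : orthonormal form s -> v \in <<s>>%VS ->
  '[v, v] = \sum_(e <- s) `|'[e, v]| ^+ 2.
Proof.
move=> os sv; rewrite [X in '[X, _]](orthonormal_expansion os sv) inner_suml.
by apply: eq_bigr => e _; rewrite innerZl mulrC normCK.
Qed.

(** [restr_mx A U] acts on columns whereas [eigenvalue] concerns rows, whence
    the transpose. *)
Lemma stable_eigenvector (A : 'End(V)) U : (A @: U <= U)%VS -> U != 0%VS ->
  exists e a, [/\ e \in U, e != 0 & A e = a *: e].
Proof.
move=> /subvP sAU U0; pose b := vbasis U.
have bU (j : 'I_(\dim U)) : b`_j \in U.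
  by rewrite vbasis_mem ?mem_nth ?size_tuple.
have Ab (j : 'I_(\dim U)) : A b`_j = \sum_i restr_mx A U i j *: b`_i.
  have Abj : A b`_j \in U by rewrite sAU // memv_img.
  by rewrite {1}(coord_vbasis Abj); apply: eq_bigr => i _; rewrite mxE.
have dU : (0 < \dim U)%N by rewrite lt0n dimv_eq0.
have [a /eigenvalueP[v vA v0]] := eigenvalue_closed (restr_mx A U)^T dU.
exists (\sum_j v 0 j *: b`_j), a; split.
- by apply: memv_suml => j _; rewrite memvZ.
- apply: contraNneq v0 => /(elimT freeP (basis_free (vbasisP U))) v0.
  by apply/eqP/rowP => j; rewrite v0 mxE.
rewrite linear_sum scaler_sumr /=.
under eq_bigr do rewrite linearZ /= Ab scaler_sumr.
rewrite exchange_big; apply: eq_bigr => i _ /=.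
rewrite scalerA; have /rowP/(_ i) := vA; rewrite !mxE => <-.
by rewrite scaler_suml; apply: eq_bigr => j _; rewrite !mxE scalerA.
Qed.

(** Induction on the dimension: an eigenvector [e] in [U] splits off, since the
    orthogonal complement of [e] in [U] is stable under a self-adjoint
    operator. *)
Lemma spectral_theorem (A : 'End(V)) U :
    (forall u v, '[A u, v] = '[u, A v]) -> (A @: U <= U)%VS ->
  exists s, [/\ orthonormal form s, <<s>>%VS = U &
    {in s, forall e, exists a, A e = a *: e}].
Proof.
move=> sA; have [n] := ubnP (\dim U); elim: n U => // n IHn U leUn sAU.
have [->|U0] := eqVneq U 0%VS.
  by exists [::]; split; rewrite ?span_nil.
have [e' [a [e'U e'0 Ae']]] := stable_eigenvector sAU U0.
have [b n1] := normalize e'0; pose e := b *: e'.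
have eU : e \in U by rewrite memvZ.
have Ae : A e = a *: e by rewrite linearZ /= Ae' !scalerA mulrC.
pose U' := (U :&: orthov form <[e]>)%VS.
have memU' u : (u \in U') = (u \in U) && ('[e, u] == 0).
  by rewrite memv_cap mem_orthov1.
have ltU' : (\dim U' < \dim U)%N.
  rewrite ltn_neqAle dimvS ?capvSl // andbT dimv_leqif_eq ?capvSl //.
  apply/negP=> /eqP U'U.
  by have := memU' e; rewrite U'U eU n1 oner_eq0.
have sAU' : (A @: U' <= U')%VS.
  apply/subvP=> _ /memv_imgP[u + ->]; rewrite !memU' => /andP[uU /eqP eu0].
  by rewrite (subvP sAU) ?memv_img //= -sA Ae innerZl eu0 mulr0.
have [s [os sU' As]] := IHn U' (leq_trans ltU' leUn) sAU'.
have es f : f \in s -> '[e, f] = 0.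
  by move=> /memv_span; rewrite sU' memU' => /andP[_ /eqP].
exists (e :: s); split.
- move: os => /andP[/= s1 so]; rewrite /orthonormal /= s1 so [form e e]n1 eqxx.
  rewrite !andbT /=; apply/allP => f /es ef /=.
  by rewrite -[form e f]/'[f, e] innerC ef conjC0.
- apply/eqP; rewrite eqEsubv span_cons sU' subv_add capvSl andbT -memvE eU /=.
  apply/subvP => u uU; rewrite -[u](subrKC ('[e, u] *: e)).
  apply: memv_add; first by rewrite memvZ ?memv_line.
  rewrite memU' rpredB ?memvZ //=.
  by rewrite innerBr innerZr n1 mulr1 subrr.
by move=> f; rewrite inE => /predU1P[->|/As//]; exists a.
Qed.
End Hermitian.

(** * Schur's lemma and its orthogonality relations *)

Section Schur.
Variables (C : numClosedFieldType) (gT : finGroupType) (G : {group gT}).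
Variables (n : nat) (rG : mx_representation C G n).
Implicit Types (g h x : gT).

Lemma card_group_neq0 : #|G|%:R != 0 :> C.
Proof. by rewrite pnatr_eq0 -lt0n cardG_gt0. Qed.

(** Unitarian trick: [rG] need not be unitary, but it preserves the positive
    definite Hermitian matrix [H], so that [rG g] is conjugate by [H] to the
    adjoint of [rG g^-1]. *)
Lemma mxtrace_reprV g : g \in G -> \tr (rG g^-1%g) = (\tr (rG g))^*.
Proof.
move=> Gg; pose H := \sum_(h in G) rG h *m (rG h)^t*.
have tM p q r (A : 'M[C]_(p, q)) (B : 'M_(q, r)) : (A *m B)^t* = B^t* *m A^t*.
  by rewrite trmx_mul map_mxM.
have Hg : rG g *m H = H *m (rG g^-1%g)^t*.
  rewrite mulmx_sumr mulmx_suml (reindex_inj (mulgI g^-1%g)) /=.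
  apply: eq_big => [h|h]; rewrite groupMl ?groupV // => Gh.
  rewrite repr_mxM ?groupV // tM !mulmxA -repr_mxM ?groupV // mulgV.
  by rewrite repr_mx1 mul1mx.
have H_unit : H \in unitmx.
  rewrite -row_free_unit -kermx_eq0; apply/eqP/row_matrixP => m; rewrite row0.
  set v := row m _; have vH : v *m H = 0 by rewrite -row_mul mulmx_ker row0.
  (* [v H v^*] is a sum of squared norms; the term [h = 1] is that of [v]. *)
  have : \sum_(h in G) dotmx (v *m rG h) (v *m rG h) = 0.
    transitivity ((v *m H *m v^t*) 0 0); last by rewrite vH mul0mx mxE.
    rewrite mulmx_sumr mulmx_suml summxE; apply: eq_bigr => h _.
    by rewrite dotmxE tM !mulmxA.
  move/eqP; rewrite psumr_eq0 => [/allP/(_ 1%g (mem_index_enum _))|h _].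
    by rewrite group1 repr_mx1 mulmx1 dnorm_eq0 => /eqP.
  exact: dnorm_ge0.
rewrite -[rG g](mulmxK H_unit) Hg mxtrace_mulC mulKmx // -map_trmx.
by rewrite mxtrace_tr trace_map_mx conjCK.
Qed.

Lemma schur_scalar (M : 'M_n) : mx_irreducible rG ->
  {in G, forall g, M *m rG g = rG g *m M} -> exists a, M = a%:M.
Proof.
move=> irr cM; have [n_gt0 _] := (mx_irrP rG).1 irr.
have [a ev] := eigenvalue_closed M n_gt0; exists a; apply/eqP.
rewrite -subr_eq0; apply: contraLR ev => Ma0.
rewrite negbK /eigenspace kermx_eq0 row_free_unit (mx_Schur irr) //.
apply/centgmxP => x Gx.
by rewrite mulmxBl mulmxBr cM // scalar_mxC.
Qed.

(** The average [N] of the conjugates of the elementary matrix [delta_mx i j]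
    is scalar by Schur's lemma; its trace determines the scalar, and its
    coefficient at [(k, l)] is the sum considered. *)
Lemma schur_orthogonality i j k l : mx_irreducible rG ->
  \sum_(g in G) rG g^-1%g k i * rG g j l =
    #|G|%:R / n%:R * (i == j)%:R * (k == l)%:R.
Proof.
move=> irr; have [n_gt0 _] := (mx_irrP rG).1 irr.
pose N := \sum_(g in G) rG g^-1%g *m delta_mx i j *m rG g.
have [h Gh|a Na] := schur_scalar irr (M := N).
  rewrite mulmx_suml mulmx_sumr (reindex_inj (mulIg h^-1%g)) /=.
  apply: eq_big => [g|g Gg]; first by rewrite groupMr ?groupV.
  rewrite groupMr ?groupV // in Gg.
  rewrite invMg invgK !repr_mxM ?groupV // -!mulmxA; do !congr (_ *m _).
  by rewrite -repr_mxM ?groupV // mulVg repr_mx1 mulmx1.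
have trN : a * n%:R = #|G|%:R * (i == j)%:R.
  rewrite mulr_natr -mxtrace_scalar -Na raddf_sum /=.
  rewrite (eq_bigr (fun=> (i == j)%:R)) => [|g Gg].
    by rewrite sumr_const mulr_natl.
  rewrite mxtrace_mulC mulmxA -repr_mxM ?groupV // mulgV repr_mx1 mul1mx.
  rewrite /mxtrace (bigD1 i) //= big1 => [|m mi]; rewrite mxE ?eqxx ?addr0 //.
  by rewrite (negbTE mi).
have n0 : n%:R != 0 :> C by rewrite pnatr_eq0 -lt0n.
have -> : #|G|%:R / n%:R * (i == j)%:R = a.
  by rewrite mulrAC -trN mulfK.
transitivity (N k l); last by rewrite Na mxE mulr_natr.
rewrite summxE; apply: eq_bigr => g _.
rewrite mxE (bigD1 j) //= big1 ?addr0 => [|m mj]; last first.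
  by rewrite mxE big1 ?mul0r // => m' _; rewrite !mxE (negbTE mj) andbF mulr0.
rewrite mxE (bigD1 i) //= big1 ?addr0 => [|m mi].
  by rewrite !mxE !eqxx mulr1.
by rewrite mxE (negbTE mi) mulr0.
Qed.

End Schur.

(** * The isotypic component *)

(** Independence of the trace from the basis.  The change-of-basis matrices
    [P] and [Q] are rectangular, since [n] and [\dim W] are only
    propositionally equal; cyclicity of the trace for rectangular products
    absorbs this. *)
Lemma mxtrace_restr_mx (C : numClosedFieldType) (V : vectType C) n
    (f : 'End(V)) (W : {vspace V}) (y : n.-tuple V) (M : 'M[C]_n) :
    basis_of W y -> (forall i : 'I_n, f y`_i = \sum_k M k i *: y`_k) ->
  \tr (restr_mx f W) = \tr M.
Proof.
move=> yW fy; pose b := vbasis W.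
pose P := \matrix_(l < \dim W, i < n) coord b l y`_i.
pose Q := \matrix_(i < n, j < \dim W) coord y i b`_j.
have bW (j : 'I_(\dim W)) : b`_j \in W.
  by rewrite vbasis_mem ?mem_nth ?size_tuple.
have yiW (i : 'I_n) : y`_i \in W by rewrite (basis_mem yW) ?mem_nth ?size_tuple.
have QP : Q *m P = 1%:M.
  apply/matrixP => i k; rewrite !mxE eq_sym -(coord_free _ _ (basis_free yW)).
  rewrite {1}(coord_vbasis (yiW k)) linear_sum; apply: eq_bigr => j _.
  by rewrite !mxE linearZ mulrC.
have -> : restr_mx f W = P *m M *m Q.
  apply/matrixP => l j; rewrite !mxE {1}(coord_basis yW (bW j)) !linear_sum.
  apply: eq_bigr => i _; rewrite !linearZ /= fy linear_sum mulrC !mxE.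
  by congr (_ * _); apply: eq_bigr => k _; rewrite !mxE linearZ mulrC.
by rewrite -mulmxA mxtrace_mulC -mulmxA QP mulmx1.
Qed.

Section Isotypic.
Variables (C : numClosedFieldType) (gT : finGroupType) (G : {group gT}).
Variables (n : nat) (rG : mx_representation C G n).
Hypothesis irr : mx_irreducible rG.
Variables (V : vectType C) (rho : gT -> 'End(V)) (chi : gT -> C).
Hypothesis rhoM : {in G &, forall g h, rho (g * h)%g = (rho g \o rho h)%VF}.
Hypothesis rG_chi : {in G, forall g, \tr (rG g) = chi g}.
Implicit Types (x : V) (y : n.-tuple V) (W : {vspace V}).

Local Notation P := (isotypic_proj G rho chi).
Local Notation Vchi := (isotypic G rho chi).

(** The map from column vectors to [V] sending the standard basis to [y] then
    commutes with the two actions of [G]. *)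
Definition intertwining y :=
  {in G, forall g (i : 'I_n), rho g y`_i = \sum_k rG g k i *: y`_k}.

(** The coordinates of the entries of [y] form a matrix [M] whose row space is
    [G]-stable, so it is everything as soon as it is nonzero; a left inverse of
    [M] kills every linear relation among the entries.  Working with the row
    space of [M] rather than with the kernel of the map defined by [y] is what
    matches [mx_irreducible], which is about row modules. *)
Lemma intertwining_free y (i : 'I_n) : intertwining y -> y`_i != 0 -> free y.
Proof.
move=> hy yi0; pose b := vbasis {:V}.
pose M := \matrix_(l < \dim {:V}, k < n) coord b l y`_k.
have modM : mxmodule rG <<M>>%MS.
  rewrite (eqmx_module _ (genmxE M)); apply/mxmoduleP => g Gg.
  pose rho_mx : 'M[C]_(\dim {:V}) := \matrix_(l, m) coord b l (rho g b`_m).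
  have -> : M *m rG g = rho_mx *m M.
    apply/matrixP => l k; rewrite !mxE; transitivity (coord b l (rho g y`_k)).
      rewrite hy // linear_sum; apply: eq_bigr => j _.
      by rewrite linearZ !mxE mulrC.
    rewrite {1}(coord_vbasis (memvf y`_k)) !linear_sum; apply: eq_bigr => m _.
    by rewrite !linearZ !mxE mulrC.
  exact: submxMl.
have M0 : <<M>>%MS != 0.
  rewrite -submx0 genmxE submx0; apply: contra yi0 => /eqP M0.
  rewrite (coord_vbasis (memvf y`_i)) big1 // => l _.
  by have /matrixP/(_ l i) := M0; rewrite !mxE => ->; rewrite scale0r.
have := ((mx_irrP rG).1 irr).2 _ modM M0; rewrite -sub1mx genmxE sub1mx.
case/row_fullP=> B BM; apply/freeP => k k0 j.
have Mk : M *m \col_m k m = 0.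
  apply/matrixP => l c; rewrite mxE [RHS]mxE.
  have /(congr1 (coord b l)) := k0.
  rewrite linear0 linear_sum => {2}<-; apply: eq_bigr => m _.
  by rewrite linearZ !mxE mulrC.
have := mul1mx (\col_m k m); rewrite -BM -mulmxA Mk mulmx0.
by move=> /matrixP/(_ j 0); rewrite !mxE.
Qed.

(** Matrix units of the group algebra applied to [x], up to a scalar: row [j] of
    [rG g^-1] gives a tuple that [G] transforms through [rG]. *)
Definition coef_tuple (j : 'I_n) x :=
  [tuple \sum_(g in G) rG g^-1%g j i *: rho g x | i < n].

Lemma coef_tuple_intertwining j x : intertwining (coef_tuple j x).
Proof.
have yE (i : 'I_n) :
    (coef_tuple j x)`_i = \sum_(g in G) rG g^-1%g j i *: rho g x.
  by rewrite -tnth_nth tnth_mktuple.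
move=> h Gh i; rewrite yE linear_sum /= (reindex_inj (mulgI h^-1%g)) /=.
under [RHS]eq_bigr do rewrite yE scaler_sumr.
rewrite exchange_big; apply: eq_big => [g|g]; rewrite groupMl ?groupV // => Gg.
rewrite linearZ /= -comp_lfunE -rhoM ?groupM ?groupV // mulKVg invMg invgK.
rewrite repr_mxM ?groupV // mxE scaler_suml; apply: eq_bigr => k _.
by rewrite scalerA mulrC.
Qed.

(** The conjugate of [chi g] is the trace of [rG g^-1], whose [j]-th diagonal
    coefficients sum to the [j]-th entry of [coef_tuple j x]. *)
Lemma isotypic_projE x : P x = (n%:R / #|G|%:R) *: \sum_j (coef_tuple j x)`_j.
Proof.
rewrite scale_lfunE sum_lfunE -rG_chi // repr_mx1 mxtrace1; congr (_ *: _).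
under [RHS]eq_bigr do rewrite -tnth_nth tnth_mktuple.
rewrite exchange_big; apply: eq_bigr => g Gg /=.
by rewrite scale_lfunE -rG_chi // -mxtrace_reprV // -scaler_suml.
Qed.

Lemma isotypic_proj_intertwining y (i : 'I_n) : intertwining y -> P y`_i = y`_i.
Proof.
move=> hy; have [n_gt0 _] := (mx_irrP rG).1 irr.
have n0 : n%:R != 0 :> C by rewrite pnatr_eq0 -lt0n.
rewrite scale_lfunE sum_lfunE -[chi 1%g]rG_chi // repr_mx1 mxtrace1.
transitivity ((n%:R / #|G|%:R) *:
    \sum_k ((#|G|%:R / n%:R) * (i == k)%:R) *: y`_k).
  congr (_ *: _).
  transitivity (\sum_(g in G) \sum_k (\sum_j rG g^-1%g j j * rG g k i) *: y`_k).
    apply: eq_bigr => g Gg.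
    rewrite scale_lfunE -rG_chi // -mxtrace_reprV // hy // scaler_sumr.
    by apply: eq_bigr => k _; rewrite scalerA mulr_suml.
  rewrite exchange_big; apply: eq_bigr => k _.
  rewrite -scaler_suml; congr (_ *: _).
  rewrite exchange_big (bigD1 i) //= schur_orthogonality // eqxx mulr1.
  rewrite big1 ?addr0 // => j ji.
  by rewrite schur_orthogonality // (negbTE ji) mulr0.
rewrite scaler_sumr (bigD1 i) //= eqxx mulr1 scalerA.
rewrite mulrA divfK ?card_group_neq0 //.
rewrite divff // scale1r big1 ?addr0 // => k ki.
by rewrite eq_sym (negbTE ki) mulr0 scale0r scaler0.
Qed.

Lemma isotypic_proj_id x : x \in Vchi -> P x = x.
Proof.
case/memv_imgP=> u _ ->; rewrite [P u]isotypic_projE linearZ linear_sum.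
congr (_ *: _); apply: eq_bigr => j _.
exact: isotypic_proj_intertwining (@coef_tuple_intertwining j u).
Qed.

(** The projector commutes with the representation because [chi] is a class
    function. *)
Lemma isotypic_subrepr : subrepr G rho Vchi.
Proof.
move=> h Gh; apply/subvP=> _ /memv_imgP[_ /memv_imgP[u _ ->] ->].
suff -> : rho h (P u) = P (rho h u) by rewrite memv_img ?memvf.
rewrite !scale_lfunE !sum_lfunE linearZ linear_sum /=; congr (_ *: _).
rewrite (reindex_inj (conjg_inj h)) /=; apply: eq_big => [g|g].
  by rewrite groupJr.
rewrite groupJr // => Gg; rewrite !scale_lfunE linearZ /= -!comp_lfunE.
rewrite -!rhoM ?groupJ // -conjgC -!rG_chi ?groupJ //.
rewrite /conjg !repr_mxM ?groupV ?groupM // mxtrace_mulC -mulmxA.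
by rewrite -repr_mxM ?groupV // mulgV repr_mx1 mulmx1.
Qed.

(** The projector fixes a nonzero [x] of [W], hence one of the tuples
    [coef_tuple j x] is nonzero by [isotypic_projE]; its entries are
    combinations of translates of [x] and so stay in [W]. *)
Lemma subrepr_intertwining W : subrepr G rho W -> (W <= Vchi)%VS -> W != 0%VS ->
  exists y, [/\ intertwining y, free y & {subset y <= W}].
Proof.
move=> sW /subvP WV; rewrite -vpick0; set x := vpick W => x0.
have Wx : x \in W := memv_pick W.
have [j yj0] : exists j, (coef_tuple j x)`_(j : 'I_n) != 0.
  apply/existsP; apply: contraNT x0 => /existsPn y0.
  rewrite -(isotypic_proj_id (WV _ Wx)) isotypic_projE big1 ?scaler0 // => j _.
  by have := y0 j; rewrite negbK => /eqP.
have hy := coef_tuple_intertwining j x.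
exists (coef_tuple j x); split; [by []|exact: intertwining_free hy yj0|].
move=> _ /mapP[i _ ->]; apply: memv_suml => g Gg.
by rewrite memvZ // (subvP (sW g Gg)) // memv_img.
Qed.

Lemma dim_subrepr_isotypic W : subrepr G rho W -> (W <= Vchi)%VS ->
  W != 0%VS -> (n <= \dim W)%N.
Proof.
move=> sW WV W0; have [y [_ fy yW]] := subrepr_intertwining sW WV W0.
by rewrite -(size_tuple y) -(eqP fy) dimvS //; apply/span_subvP.
Qed.

Lemma isotypic_subrepr_dim_irr W : subrepr G rho W -> (W <= Vchi)%VS ->
  \dim W = n -> irr_subrepr G rho W.
Proof.
move=> sW WV dW; split=> // [|U sU UW U0].
  by rewrite -dimv_eq0 dW -lt0n; have [] := (mx_irrP rG).1 irr.
apply/eqP; rewrite eqEdim UW dW dim_subrepr_isotypic //.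
exact: subv_trans UW WV.
Qed.

Lemma isotypic_subrepr_dim_character W : subrepr G rho W -> (W <= Vchi)%VS ->
  \dim W = n -> has_character G rho chi W.
Proof.
move=> sW WV dW.
have W0 : W != 0%VS.
  by rewrite -dimv_eq0 dW -lt0n; have [] := (mx_irrP rG).1 irr.
have [y [hy fy yW]] := subrepr_intertwining sW WV W0.
have By : basis_of W y.
  by rewrite basisEfree fy size_tuple dW leqnn andbT; apply/span_subvP.
by move=> g Gg; rewrite (mxtrace_restr_mx By (hy g Gg)) rG_chi.
Qed.

Lemma has_character_dim W : rho 1%g = \1%VF -> has_character G rho chi W ->
  \dim W = n.
Proof.
move=> rho1 /(_ 1%g (group1 G)); rewrite -rG_chi // repr_mx1 mxtrace1.
rewrite (mxtrace_restr_mx (M := 1%:M) (vbasisP W)) => [|i]; last first.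
  rewrite rho1 id_lfunE (bigD1 i) //= mxE eqxx scale1r big1 ?addr0 // => k ki.
  by rewrite mxE (negbTE ki) scale0r.
by rewrite mxtrace1 => /eqP; rewrite eqr_nat => /eqP.
Qed.
End Isotypic.

(** * The frame operator of an orbit *)

Section Frame.
Variables (C : numClosedFieldType) (V : vectType C).
Variable form : {dot V for Num.conj}.

Local Notation "''[' u , v ]" := (inner form u v) : ring_scope.

Definition rank_one (w u : V) : V := '[w, u] *: w.

Lemma rank_one_is_linear w : linear (rank_one w).
Proof. by move=> a u v; rewrite /rank_one innerDr innerZr scalerDl scalerA. Qed.

HB.instance Definition _ w :=
  GRing.isLinear.Build C V V _ (rank_one w) (rank_one_is_linear w).

Variables (gT : finGroupType) (G : {group gT}) (rho : gT -> 'End(V)).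
Hypothesis hrho : unitary_repr G form rho.
Implicit Types (u v w : V) (U E : {vspace V}).

Let rho1 : rho 1%g = \1%VF. Proof. by case: hrho. Qed.
Let rhoM g h v : g \in G -> h \in G -> rho (g * h)%g v = rho g (rho h v).
Proof. by case: hrho => _ hM _ Gg Gh; rewrite hM // comp_lfunE. Qed.
Let rho_inner g u v : g \in G -> '[rho g u, rho g v] = '[u, v].
Proof. by case: hrho => _ _ hI Gg; apply: hI. Qed.

(** The frame operator of the orbit of [v]: for a unit vector [v], the average
    of the orthogonal projectors onto the lines of the orbit. *)
Definition frame_op v : 'End(V) :=
  #|G|%:R^-1 *: \sum_(g in G) linfun (rank_one (rho g v)).

Lemma frame_opE v u :
  frame_op v u = #|G|%:R^-1 *: \sum_(g in G) '[rho g v, u] *: rho g v.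
Proof.
by rewrite scale_lfunE sum_lfunE; under eq_bigr do rewrite lfunE.
Qed.

Lemma inner_frame_op v u w :
  '[w, frame_op v u] = #|G|%:R^-1 * \sum_(g in G) '[w, rho g v] * '[rho g v, u].
Proof.
rewrite frame_opE innerZr inner_sumr; congr (_ * _).
by apply: eq_bigr => g _; rewrite innerZr mulrC.
Qed.

Lemma inner_frame_op_diag v u :
  '[u, frame_op v u] = #|G|%:R^-1 * \sum_(g in G) `|'[u, rho g v]| ^+ 2.
Proof.
rewrite inner_frame_op; congr (_ * _); apply: eq_bigr => g _.
by rewrite normCK -innerC.
Qed.

Lemma F_frame_op v : F G form rho v = '[v, frame_op v v].
Proof. by rewrite inner_frame_op_diag. Qed.

Lemma frame_op_selfadjoint v u w : '[frame_op v u, w] = '[u, frame_op v w].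
Proof.
rewrite innerC !inner_frame_op rmorphM rmorph_sum fmorphV rmorph_nat /=.
congr (_ * _); apply: eq_bigr => g _.
by rewrite rmorphM /= -!innerC mulrC.
Qed.

Lemma frame_op_commute v h u : h \in G ->
  frame_op v (rho h u) = rho h (frame_op v u).
Proof.
move=> Gh; rewrite !frame_opE [RHS]linearZ [in RHS]linear_sum; congr (_ *: _).
rewrite (reindex_inj (mulgI h)) /=; apply: eq_big => [g|g].
  by rewrite groupMl.
by rewrite groupMl // => Gg; rewrite linearZ /= !rhoM // rho_inner.
Qed.

Lemma frame_op_stable E v : subrepr G rho E -> v \in E ->
  (frame_op v @: E <= E)%VS.
Proof.
move=> sE vE; apply/subvP=> _ /memv_imgP[u _ ->]; rewrite frame_opE.
apply/memvZ/memv_suml => g Gg.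
by rewrite memvZ // (subvP (sE g Gg)) // memv_img.
Qed.

Definition frame_eigenspace v a U : {vspace V} :=
  (U :&: lker (frame_op v - a *: \1%VF))%VS.

Lemma mem_frame_eigenspace v a U u :
  (u \in frame_eigenspace v a U) = (u \in U) && (frame_op v u == a *: u).
Proof.
by rewrite memv_cap (sameP eqlfunP eqP) (scale_lfunE a \1%VF) id_lfunE.
Qed.

(** Invariance is inherited because [frame_op v] commutes with the action. *)
Lemma frame_eigenspace_subrepr v a U : subrepr G rho U ->
  subrepr G rho (frame_eigenspace v a U).
Proof.
move=> sU g Gg; apply/subvP=> _ /memv_imgP[u + ->].
rewrite !mem_frame_eigenspace => /andP[uU /eqP Au].
by rewrite (subvP (sU g Gg)) ?memv_img //= frame_op_commute // Au linearZ.
Qed.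

Lemma orthonormal_basis E :
  exists s, [/\ orthonormal form s, <<s>>%VS = E & size s = \dim E].
Proof.
have id_sa u v : '[\1%VF u, v] = '[u, \1%VF v] by rewrite !id_lfunE.
have sE : (\1 @: E <= E)%VS by rewrite lim1g.
have [s [os <- _]] := spectral_theorem id_sa sE.
by exists s; split=> //; rewrite (eqP (orthonormal_free os)).
Qed.

(** Both sides are the trace of [frame_op v] on the span of [s], computed from
    the eigenvalue and from the definition. *)
Lemma frame_op_trace v a (s : seq V) :
    orthonormal form s -> {in s, forall e, frame_op v e = a *: e} ->
  (size s)%:R * a =
    #|G|%:R^-1 * \sum_(g in G) \sum_(e <- s) `|'[e, rho g v]| ^+ 2.
Proof.
move=> os As; rewrite exchange_big mulr_sumr big_seq.
rewrite (eq_bigr (fun=> a)) => [|e se]; last first.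
  rewrite -inner_frame_op_diag As // innerZr.
  by rewrite (inner_orthonormal os) // eqxx mulr1.
by rewrite -big_seq big_const_seq count_predT iter_addr_0 mulr_natl.
Qed.

Lemma average_const a : #|G|%:R^-1 * \sum_(g in G) a = a :> C.
Proof. by rewrite sumr_const -[a *+ _]mulr_natl mulKf // card_group_neq0. Qed.

(** In [frame_op_trace], the inner sum is the squared norm of the projection
    of [rho g v] on [E]. *)
Lemma frame_op_eigen_le E v a : {in E, forall u, frame_op v u = a *: u} ->
  (\dim E)%:R * a <= '[v, v].
Proof.
move=> AE; have [s [os sE <-]] := orthonormal_basis E.
rewrite (@frame_op_trace v a s) //; last first.
  by move=> e /memv_span; rewrite sE; apply: AE.
rewrite -[leRHS]average_const ler_wpM2l ?invr_ge0 ?ler0n //.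
by apply: ler_sum => g Gg; rewrite -(rho_inner v v Gg) bessel.
Qed.

(** Here the orbit of [v] lies in [E], so the projections on [E] lose
    nothing. *)
Lemma frame_op_eigen_eq E v a : subrepr G rho E -> v \in E ->
    {in E, forall u, frame_op v u = a *: u} ->
  (\dim E)%:R * a = '[v, v].
Proof.
move=> sE vE AE; have [s [os sE' <-]] := orthonormal_basis E.
rewrite (@frame_op_trace v a s) //; last first.
  by move=> e /memv_span; rewrite sE'; apply: AE.
rewrite -[RHS]average_const; congr (_ * _); apply: eq_bigr => g Gg.
rewrite -(rho_inner v v Gg) -parseval // sE'.
by rewrite (subvP (sE g Gg)) // memv_img.
Qed.

Lemma frame_op_ge0 v u : 0 <= '[u, frame_op v u].
Proof.
rewrite inner_frame_op_diag mulr_ge0 ?invr_ge0 ?ler0n //.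
by apply: sumr_ge0 => g _; rewrite exprn_ge0.
Qed.
End Frame.

(** * The maximum of F and its maximizers *)

Section Extremal.
Variables (C : numClosedFieldType) (V : vectType C).
Variable form : {dot V for Num.conj}.
Variables (gT : finGroupType) (G : {group gT}) (rho : gT -> 'End(V)).
Variables (n : nat) (rG : mx_representation C G n) (chi : gT -> C).
Hypothesis hrho : unitary_repr G form rho.
Hypothesis irr : mx_irreducible rG.
Hypothesis rG_chi : {in G, forall g, \tr (rG g) = chi g}.
Implicit Types (u v w : V) (W : {vspace V}).

Local Notation "''[' u , v ]" := (inner form u v) : ring_scope.
Local Notation Vchi := (isotypic G rho chi).
Local Notation A := (frame_op form G rho).
Local Notation F := (F G form rho).
Local Notation sphere := (isotypic_sphere G form rho chi).

Let rho1 : rho 1%g = \1%VF. Proof. by case: hrho. Qed.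
Let rhoM : {in G &, forall g h, rho (g * h)%g = (rho g \o rho h)%VF}.
Proof. by case: hrho. Qed.

Let sVchi : subrepr G rho Vchi := isotypic_subrepr rhoM rG_chi.
Let n_gt0 : 0 < n%:R :> C.
Proof. by rewrite ltr0n; have [] := (mx_irrP rG).1 irr. Qed.

Lemma orbit_span_subrepr v : subrepr G rho (orbit_span G rho v).
Proof.
move=> h Gh; rewrite limg_span.
apply/span_subvP => _ /mapP[_ /imageP[g Gg ->] ->].
by rewrite -comp_lfunE -rhoM // memv_span // image_f // groupM.
Qed.

Lemma mem_orbit_span v : v \in orbit_span G rho v.
Proof.
apply: memv_span; apply/imageP; exists 1%g; first exact: group1.
by rewrite rho1 id_lfunE.
Qed.

Lemma orbit_span_sub W v : subrepr G rho W -> v \in W ->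
  (orbit_span G rho v <= W)%VS.
Proof.
move=> sW vW; apply/span_subvP => _ /imageP[g Gg ->].
by rewrite (subvP (sW g Gg)) // memv_img.
Qed.

(** The eigenspace of [a] in the isotypic component is a nonzero
    subrepresentation, so its dimension is at least [n], while
    [frame_op_eigen_le] bounds [a] by the inverse of this dimension. *)
Lemma frame_op_eigenvalue_le v e a : '[v, v] = 1 -> e \in Vchi -> e != 0 ->
  A v e = a *: e -> a <= n%:R^-1.
Proof.
move=> v1 eV e0 Ae; pose E := frame_eigenspace form G rho v a Vchi.
have eE : e \in E by rewrite mem_frame_eigenspace eV Ae eqxx.
have E0 : E != 0%VS by apply: contraNneq e0 => E0; rewrite -memv0 -E0.
have dE : (n <= \dim E)%N.
  apply: (dim_subrepr_isotypic irr rhoM rG_chi) E0; last exact: capvSl.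
  exact: frame_eigenspace_subrepr.
have a0 : 0 <= a.
  have := frame_op_ge0 form G rho v e.
  by rewrite Ae innerZr pmulr_lge0 // lt_def inner_ge0 inner_eq0 e0.
have AE : {in E, forall u, A v u = a *: u}.
  by move=> u; rewrite mem_frame_eigenspace => /andP[_ /eqP].
have := frame_op_eigen_le hrho AE; rewrite v1.
rewrite -[n%:R^-1]div1r ler_pdivlMr // [a * _]mulrC; apply: le_trans.
by rewrite ler_wpM2r // ler_nat.
Qed.

(** In an orthonormal eigenbasis [s] with eigenvalues [l e], and with [c e] the
    coordinates of [v], the defect [1/n - F v] is a sum of nonnegative terms
    [(1/n - l e) * |c e|^2].  If it vanishes, only eigenvectors with [l e = 1/n]
    contribute to [v]. *)
Lemma F_le v : sphere v ->
  F v <= n%:R^-1 /\ (F v = n%:R^-1 -> A v v = n%:R^-1 *: v).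
Proof.
case=> vV /hnorm_eq1 v1.
have sA u w : '[A v u, w] = '[u, A v w] by rewrite frame_op_selfadjoint.
have [s [os sV As]] := spectral_theorem sA (frame_op_stable form sVchi vV).
pose c e := '[e, v]; pose l e := '[e, A v e].
have Al e : e \in s -> A v e = l e *: e.
  move=> se; have [a Ae] := As e se.
  by rewrite /l Ae innerZr (inner_orthonormal os) // eqxx mulr1.
have l_le e : e \in s -> l e <= n%:R^-1.
  move=> se; apply: frame_op_eigenvalue_le v1 _ _ (Al e se).
    by rewrite -sV memv_span.
  by rewrite -(inner_eq0 form) (inner_orthonormal os) // eqxx oner_eq0.
have vE : v = \sum_(e <- s) c e *: e.
  by apply: orthonormal_expansion; rewrite // sV.
have AvE : A v v = \sum_(e <- s) (c e * l e) *: e.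
  rewrite {2}vE linear_sum big_seq [RHS]big_seq; apply: eq_bigr => e se.
  by rewrite linearZ /= Al // scalerA.
have gap : n%:R^-1 - F v = \sum_(e <- s) (n%:R^-1 - l e) * `|c e| ^+ 2.
  have {1}-> : n%:R^-1 = n%:R^-1 * \sum_(e <- s) `|c e| ^+ 2 :> C.
    by rewrite -(@parseval _ _ form) ?sV // v1 mulr1.
  rewrite F_frame_op AvE inner_sumr mulr_sumr -sumrB; apply: eq_bigr => e _.
  rewrite innerZr ['[v, e]]innerC -/(c e) mulrBl normCK; congr (_ - _).
  by rewrite [c e * l e]mulrC mulrA.
have gap_ge0 e : e \in s -> 0 <= (n%:R^-1 - l e) * `|c e| ^+ 2.
  by move=> se; rewrite mulr_ge0 ?exprn_ge0 // subr_ge0 l_le.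
split; first by rewrite -subr_ge0 gap big_seq sumr_ge0.
move=> Fv; rewrite AvE {1}vE scaler_sumr big_seq [RHS]big_seq.
apply: eq_bigr => e se; rewrite scalerA mulrC; congr (_ *: _).
have /eqP := gap; rewrite Fv subrr eq_sym big_seq psumr_eq0 //.
move=> /allP/(_ e se); rewrite se mulf_eq0 subr_eq0 expf_eq0 normr_eq0 /=.
by case/orP=> /eqP->; rewrite ?mulr0.
Qed.

(** The eigenspace of [1/n], being invariant, contains the whole orbit span;
    the trace identity on the orbit span then reads [\dim * 1/n = 1]. *)
Lemma frame_op_eigenvector_dim v : sphere v -> A v v = n%:R^-1 *: v ->
  \dim (orbit_span G rho v) = n.
Proof.
case=> vV /hnorm_eq1 v1 Av; set W := orbit_span G rho v.
have WE : (W <= frame_eigenspace form G rho v n%:R^-1 Vchi)%VS.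
  apply: orbit_span_sub; first exact: frame_eigenspace_subrepr.
  by rewrite mem_frame_eigenspace vV Av eqxx.
have AW : {in W, forall u, A v u = n%:R^-1 *: u}.
  by move=> u /(subvP WE); rewrite mem_frame_eigenspace => /andP[_ /eqP].
have := frame_op_eigen_eq hrho (orbit_span_subrepr v) (mem_orbit_span v) AW.
have n0 : n%:R != 0 :> C by rewrite gt_eqF.
rewrite v1 => dW; apply/eqP.
by rewrite -(eqr_nat C) -(inj_eq (mulIf (invr_neq0 n0))) dW mulfV.
Qed.

(** Schur's lemma for the frame operator: it has an eigenvector in the orbit
    span, whose eigenspace is invariant and hence is the whole span.  The trace
    identity gives the value of the scalar. *)
Lemma F_irr v : sphere v -> irr_subrepr G rho (orbit_span G rho v) ->
  \dim (orbit_span G rho v) = n -> F v = n%:R^-1.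
Proof.
set W := orbit_span G rho v; case=> vV /hnorm_eq1 v1 [sW W0 minW] dW.
have vW : v \in W := mem_orbit_span v.
have [e [a [eW e0 Ae]]] := stable_eigenvector (frame_op_stable form sW vW) W0.
have EW : frame_eigenspace form G rho v a W = W.
  apply: minW; [exact: frame_eigenspace_subrepr|exact: capvSl|].
  apply: contraNneq e0 => E0; rewrite -memv0 -E0.
  by rewrite mem_frame_eigenspace eW Ae eqxx.
have AW : {in W, forall u, A v u = a *: u}.
  by move=> u; rewrite -{1}EW mem_frame_eigenspace => /andP[_ /eqP].
have := frame_op_eigen_eq hrho sW vW AW; rewrite v1 dW => na.
have n0 : n%:R != 0 :> C by rewrite gt_eqF.
rewrite F_frame_op AW // innerZr v1 mulr1.
by apply: (mulfI n0); rewrite na mulfV.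
Qed.

Definition irr_generator v :=
  [/\ sphere v, irr_subrepr G rho (orbit_span G rho v) &
      has_character G rho chi (orbit_span G rho v)].

Lemma F_irr_generator v : sphere v -> F v = n%:R^-1 <-> irr_generator v.
Proof.
move=> Sv; split=> [Fv|[_ irrW chW]]; last first.
  by apply: F_irr irrW _ => //; exact: (has_character_dim rG_chi rho1 chW).
have dW := frame_op_eigenvector_dim Sv ((F_le Sv).2 Fv).
have sW := orbit_span_subrepr v.
have WV := orbit_span_sub sVchi Sv.1.
split=> //; first exact: (isotypic_subrepr_dim_irr irr rhoM rG_chi).
exact: (isotypic_subrepr_dim_character irr rhoM rG_chi).
Qed.

(** Any unit vector in a copy of [rG] inside the isotypic component generates
    that copy, since there is no room for a smaller nonzero
    subrepresentation. *)
Lemma irr_generator_exists : Vchi != 0%VS -> exists v, irr_generator v.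
Proof.
move=> V0.
have [y [hy fy yV]] := subrepr_intertwining irr rhoM rG_chi sVchi (subvv _) V0.
have sU : subrepr G rho <<y>>.
  move=> g Gg; rewrite limg_span.
  apply/span_subvP => _ /mapP[_ /tnthP[i ->] ->].
  rewrite (tnth_nth 0) (hy g Gg i).
  by apply: memv_suml => k _; rewrite memvZ // memv_span // mem_nth ?size_tuple.
have dU : \dim <<y>> = n by rewrite (eqP fy) size_tuple.
have y0 : vpick <<y>> != 0 by rewrite vpick0 -dimv_eq0 dU -lt0n -(ltr0n C).
have [a v1] := normalize form y0; set v := a *: _ in v1.
have vU : v \in <<y>>%VS by rewrite memvZ ?memv_pick.
have vV : v \in Vchi by apply: (subvP _) vU; apply/span_subvP.
exists v; set W := orbit_span G rho v.
have sW : subrepr G rho W := orbit_span_subrepr v.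
have WV : (W <= Vchi)%VS := orbit_span_sub sVchi vV.
have W0 : W != 0%VS.
  apply: contraNneq (oner_neq0 C) => W0; rewrite -v1 inner_eq0 -memv0 -W0.
  exact: mem_orbit_span.
have dW : \dim W = n.
  apply/eqP; rewrite eqn_leq -{1}dU dimvS ?orbit_span_sub //=.
  exact: (dim_subrepr_isotypic irr rhoM rG_chi).
split; first by split=> //; apply/hnorm_eq1.
  exact: (isotypic_subrepr_dim_irr irr rhoM rG_chi).
exact: (isotypic_subrepr_dim_character irr rhoM rG_chi).
Qed.
End Extremal.

Theorem corollary2 (R : realType) (gT : finGroupType) (G : {group gT})
    (V : vectType R[i]) (form : {dot V for Num.conj}) (rho : gT -> 'End(V))
    (chi : gT -> R[i]) (d : nat)
    (hrho : unitary_repr G form rho)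
    (hchi : irr_character G chi)
    (hd : chi 1%g = d%:R)
    (hV : isotypic G rho chi != 0%VS) :
  is_max (isotypic_sphere G form rho chi) (F G form rho) d%:R^-1 /\
  (forall v : V,
     is_maximizer (isotypic_sphere G form rho chi) (F G form rho) v <->
     [/\ isotypic_sphere G form rho chi v,
         irr_subrepr G rho (orbit_span G rho v) &
         has_character G rho chi (orbit_span G rho v)]).
Proof.
have [n [rG [irr rG_chi]]] := hchi.
have nd : n = d.
  apply/eqP; rewrite -(eqr_nat R[i]) -hd -rG_chi //.
  by rewrite repr_mx1 mxtrace1.
rewrite -nd => {nd hd}.
have F_gen := F_irr_generator hrho irr rG_chi.
have F_max v : isotypic_sphere G form rho chi v -> F G form rho v <= n%:R^-1.
  by case/(F_le hrho irr rG_chi).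
have [w gw] := irr_generator_exists hrho irr rG_chi hV.
have [Sw _ _] := gw; have Fw := (F_gen w Sw).2 gw.
split; first by exists w => //; split=> // v /F_max; rewrite Fw.
move=> v; split=> [[Sv maxv]|gv].
  apply/F_gen => //; apply/eqP; rewrite eq_le F_max //.
  by rewrite -Fw maxv.
have [Sv _ _] := gv; split=> // u /F_max.
by rewrite ((F_gen v Sv).2 gv).
Qed.
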